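(* Let $n,k\in\mathbb{N}$ and let $x_1,\dots,x_{kn},y_1,\dots,y_n$ be commutative variables. Put $$C_{n,k}(x,y)=\Bigl(\frac1{x_i+y_j}\Bigr)_{1\le i\le kn,\;1\le j\le n},\qquad V_{n,k}(x)=(x_i^{n-j})_{1\le i\le kn,\;1\le j\le n}.$$ Then $$\operatorname{wrdet}_k C_{n,k}(x,y)=\frac{\Delta_n(y)^k}{\prod_{1\le i\le kn,\;1\le j\le n}(x_i+y_j)}\operatorname{wrdet}_k V_{n,k}(x),$$ where $\Delta_n(y)=\prod_{1\le i<j\le n}(y_i-y_j)$.
   Context: $\mathfrak{S}_N$ is the symmetric group of degree $N$ and $\nu_N(w)$ is the number of cycles of $w\in\mathfrak{S}_N$ (fixed points included). For an $N\times N$ matrix $B=(b_{ij})$ with entries in a commutative $\mathbb{C}$-algebra, $\det_k B:=\sum_{w\in\mathfrak{S}_N}(-\tfrac1k)^{N-\nu_N(w)}b_{w(1)1}\cdots b_{w(N)N}$. For a matrix $A$ with $n$ columns, $A^{[k]}$ is the matrix with $kn$ columns obtained by repeating each column of $A$ $k$ times consecutively. The $k$-th wreath determinant of a $kn\times n$ matrix $A$ is $\operatorname{wrdet}_k A:=\det_k(A^{[k]})$. *)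

(* Defs.v *)
From HB Require Import structures.
From mathcomp Require Import all_boot all_order all_fingroup all_algebra.
From mathcomp Require Import reals complex.

Set Implicit Arguments.
Unset Strict Implicit.
Unset Printing Implicit Defensive.

Import GRing.Theory.
Local Open Scope ring_scope.

(* The complex numbers are [R[i]] for [R : realType]; a commutative C-algebra
   is a [comAlgType R[i]]. *)

(* [porbits w] contains the singleton orbits, so [#|porbits w|] counts fixed
   points as cycles.  For [k = 0] the scalar is the junk value [- 0^-1 = 0]. *)
Definition kdet (R : realType) (A : comAlgType R[i]) (k N : nat)
    (B : 'M[A]_N) : A :=
  \sum_(w : 'S_N)
    (- (k%:R^-1 : R[i])) ^+ (N - #|porbits w|) *: \prod_(j < N) B (w j) j.

Fact repcol_subproof (k n : nat) (j : 'I_(k * n)) : (j %/ k < n)%N.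
Proof.
case: k j => [[m] //|k] j.
by rewrite ltn_divLR // [(n * _)%N]mulnC ltn_ord.
Qed.

(* Counting from 0, the columns [k * c, ..., k * c + k - 1] of [A^[k]] are the
   [k] consecutive copies of column [c] of [A]. *)
Definition repcols (T : Type) (k m n : nat) (A : 'M[T]_(m, n)) :
    'M[T]_(m, k * n) :=
  \matrix_(i < m, j < k * n) A i (Ordinal (repcol_subproof j)).

Definition wrdet (R : realType) (A : comAlgType R[i]) (k n : nat)
    (M : 'M[A]_(k * n, n)) : A :=
  kdet k (repcols k M).

Definition cauchymx (A : unitRingType) (n k : nat)
    (x : 'I_(k * n) -> A) (y : 'I_n -> A) : 'M[A]_(k * n, n) :=
  \matrix_(i < k * n, j < n) (x i + y j)^-1.

(* [j] counts from 0, hence the exponent [n - j.+1] for the 1-based [n - j]. *)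
Definition vandermx (A : pzRingType) (n k : nat) (x : 'I_(k * n) -> A) :
    'M[A]_(k * n, n) :=
  \matrix_(i < k * n, j < n) x i ^+ (n - j.+1).

Definition vdprod (A : comPzRingType) (n : nat) (y : 'I_n -> A) : A :=
  \prod_(i < n) \prod_(j < n | (i < j)%N) (y i - y j).

(* Main.v *)
Require Import Defs.
From HB Require Import structures.
From mathcomp Require Import all_boot all_order all_fingroup all_algebra.
From mathcomp Require Import reals complex.

Set Implicit Arguments.
Unset Strict Implicit.
Unset Printing Implicit Defensive.

Import GRing.Theory.
Local Open Scope ring_scope.

(** Right multiplication of [M] by a triangular matrix [T] multiplies
    [wrdet M] by the [k]-th power of the product of the diagonal of [T]
    ([wrdet_mulmx_triangular]), and the Cauchy matrix is obtained from the
    Vandermonde matrix by scaling rows and by two such multiplications.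

    The triangular rule rests on an expansion of [kdet] into determinants.
    Since [(-1) ^ (N - nu(w))] is the signature of [w] and [k ^ nu(w)] is the
    number of [k]-colorings of the indices that are invariant under [w],
    [kdet k B] is [k ^ - N] times the sum, over all colorings [c], of the
    determinant of [B] with the entries joining indices of different colors
    erased ([kdet_sum_det]).  If more than [k] columns of [B] agree, two of
    them have the same color under every [c], and every determinant in the sum
    vanishes ([kdet_eq_columns]).

    Expand [wrdet (M *m T)] by multilinearity in its [k * n] columns: each
    function [f] selecting a column of [M] for every position contributes a
    [kdet] that vanishes unless [f] takes every value at most, hence exactly,
    [k] times.  If [T] is lower (upper) triangular, [f] must moreover be
    pointwise at least (at most) the function [j %/ k] that gives the original
    columns; as the values of the two functions have the same sum, they are
    equal, and a single term survives.

    For the Cauchy matrix, fix a row [x] and put [a_l = x + y_l].  A telescoping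
    sum ([prod_sub_prod_shift]) gives
      [1 / a_j = (prod_l a_l)^-1 *
         sum_b (prod_(l > b) a_l) * (prod_(l < b) (y_l - y_j))].
    The second factor is an upper triangular matrix in [(b, j)], whose
    diagonal has product [vdprod y].  The first is a monic polynomial in [x] of
    degree [n - 1 - b], so it is the Vandermonde matrix times a lower
    unitriangular matrix ([shifted_prods_vandermx]). *)

(** * Colorings invariant under a permutation *)

(** An invariant coloring is one that is constant on cycles, so it amounts to a
    choice of one color for each cycle. *)
Lemma card_invariant_colorings (T : finType) (k : nat) (w : {perm T}) :
  (0 < k)%N ->
  #|[set c : {ffun T -> 'I_k} | [forall t, c (w t) == c t]]|
    = (k ^ #|porbits w|)%N.
Proof.
move=> hk; pose y0 := Ordinal hk.
pose color_cycles (g : {ffun {set T} -> 'I_k}) := [ffun t => g (porbit w t)].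
rewrite -[k in RHS]card_ord.
rewrite -(card_pffun_on y0 (mem (porbits w)) 'I_k).
rewrite -(card_in_imset (f := color_cycles)); last first.
  (* Injectivity: the functions at hand take the default color [y0] off the
     cycles, and every cycle contains a point. *)
  move=> g h /pffun_onP[/subsetP sg _] /pffun_onP[/subsetP sh _] e.
  apply/ffunP=> O; have [/imsetP[t _ ->]|nO] := boolP (O \in porbits w).
    by move/ffunP: e => /(_ t); rewrite !ffunE.
  have -> : g O = y0 by apply/eqP; apply: contraNT nO; exact: sg.
  by apply/esym/eqP; apply: contraNT nO; exact: sh.
apply: eq_card => c; rewrite inE; apply/forallP/imsetP.
  move=> inv; have invX t i : c ((w ^+ i)%g t) = c t.
    elim: i => [|i IH]; first by rewrite expg0 perm1.
    by rewrite expgSr permM (eqP (inv _)).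
  exists [ffun O : {set T} => if [pick t in O | O \in porbits w] is Some t
                              then c t else y0].
    apply/pffun_onP; split=> //; apply/subsetP=> O; rewrite inE ffunE.
    by case: pickP => [t /andP[_ ->] //|_]; rewrite eqxx.
  apply/ffunP=> t; rewrite !ffunE.
  case: pickP => [s /andP[/porbitP[i ->] _]|/(_ t)]; first by rewrite invX.
  by rewrite porbit_id imset_f.
case=> g _ -> t; rewrite !ffunE; apply/eqP; congr (g _).
by have := porbit_perm w 1 t; rewrite expg1.
Qed.

(** * Functions with fibers of bounded size *)

(** The [n] fibers have total size [k * n], so none of them can be smaller than
    the bound [k]. *)
Lemma balanced_fiber (I : finType) (n k : nat) (f : I -> 'I_n) :
  #|I| = (k * n)%N -> (forall b, (#|[set j | f j == b]| <= k)%N) ->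
  forall b, #|[set j | f j == b]| = k.
Proof.
move=> cardI lef b; have := @leqif_sum _ xpredT _ _ _
  (fun b _ => leqif_eq (lef b)).
have -> : (\sum_b #|[set j | f j == b]|)%N = #|I|.
  rewrite -sum1_card (partition_big f xpredT) //=; apply: eq_bigr => c _.
  by rewrite sum1dep_card.
rewrite sum_nat_const card_ord cardI mulnC => -[_]; rewrite eqxx.
by move/esym/forallP/(_ b)/eqP.
Qed.

(** Both functions take every value exactly [k] times, so their values have the
    same sum; a pointwise inequality must then be an equality. *)
Lemma balanced_le_eq (I : finType) (n k : nat) (f g : I -> 'I_n) :
  #|I| = (k * n)%N ->
  (forall b, (#|[set j | f j == b]| <= k)%N) ->
  (forall b, (#|[set j | g j == b]| <= k)%N) ->
  (forall j, (f j <= g j)%N) -> f =1 g.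
Proof.
move=> cardI fib_f fib_g lefg j.
have sumE (h : I -> 'I_n) : (forall b, (#|[set j | h j == b]| <= k)%N) ->
    (\sum_(j : I) (h j : nat) = \sum_(b < n) k * b)%N.
  move=> fib_h; rewrite (partition_big h xpredT) //=; apply: eq_bigr => b _.
  rewrite (eq_bigr (fun=> b : nat)) => [|i /eqP-> //].
  by rewrite sum_nat_const -(balanced_fiber cardI fib_h b) cardsE.
have := @leqif_sum _ xpredT _ _ _ (fun j _ => leqif_eq (lefg j)).
rewrite sumE // sumE // => -[_]; rewrite eqxx => /esym/forallP/(_ j)/eqP.
exact: val_inj.
Qed.

(** * The k-determinant and the wreath determinant *)

Section KDet.
Variables (R : realType) (A : comAlgType R[i]).

(** The determinants on the right expand into signed products over the [w] that
    leave [c] invariant; exchanging the sums, each [w] is counted once for each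
    of its [k ^ nu(w)] invariant colorings, and its sign is
    [(-1) ^ (N - nu(w))]. *)
Lemma kdet_sum_det (k N : nat) (B : 'M[A]_N) : (0 < k)%N ->
  kdet k B = (k%:R^-1 : R[i]) ^+ N *:
    \sum_(c : {ffun 'I_N -> 'I_k})
       \det (\matrix_(i, j) (B i j *+ (c i == c j))).
Proof.
move=> hk; have k0 : (k%:R : R[i]) != 0 by rewrite Num.Theory.pnatr_eq0 -lt0n.
under eq_bigr => c _ do rewrite -det_tr.
rewrite exchange_big scaler_sumr; apply: eq_bigr => w _ /=.
rewrite -mulr_sumr.
have E (c : {ffun 'I_N -> 'I_k}) :
    \prod_j (\matrix_(i, j) (B i j *+ (c i == c j)))^T j (w j)
      = (\prod_j B (w j) j) *+ [forall t, c (w t) == c t].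
  have [/forallP inv|/forallPn[t /negPf ct]] :=
      boolP [forall t, c (w t) == c t].
    by rewrite mulr1n; apply: eq_bigr => j _; rewrite !mxE inv.
  by rewrite (bigD1 t) //= !mxE ct mul0r.
rewrite (eq_bigr _ (fun c _ => E c)).
rewrite sumrMnr.
have -> : (\sum_(c : {ffun 'I_N -> 'I_k}) [forall t, c (w t) == c t])%N
    = (k ^ #|porbits w|)%N.
  rewrite -card_invariant_colorings // -sum1dep_card [RHS]big_mkcond /=.
  by apply: eq_bigr => c _; case: ifP.
have leN : (#|porbits w| <= N)%N.
  by rewrite -[leqRHS](card_ord N); exact: leq_imset_card.
set v := #|porbits w| in leN *; set P := \prod_j _.
have -> : (-1) ^+ w = (-1) ^+ (N - v) :> A.
  by rewrite -[RHS]signr_odd oddB // /odd_perm card_ord.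
have -> : (-1) ^+ (N - v) * (P *+ (k ^ v)) =
    ((-1) ^+ (N - v) * k%:R ^+ v : R[i]) *: P.
  rewrite -scalerA -natrX scaler_nat -!(signr_odd _ (N - v)).
  by rewrite mulr_sign scaler_sign.
rewrite scalerA [in LHS]exprNn mulrCA; congr (_ *: _).
have -> : k%:R^-1 ^+ N = k%:R^-1 ^+ (N - v) * k%:R^-1 ^+ v :> R[i].
  by rewrite -exprD subnK.
by rewrite -mulrA -[_ ^+ v * _]exprMn mulVf // expr1n mulr1.
Qed.

Lemma kdet_expand_columns (k N n : nat) (col : 'I_N -> 'I_n)
    (M : 'M[A]_(N, n)) (T : 'M[A]_n) :
  kdet k (\matrix_(i, j) (M *m T) i (col j)) =
  \sum_(f : {ffun 'I_N -> 'I_n})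
     (\prod_j T (f j) (col j)) * kdet k (\matrix_(i, j) M i (f j)).
Proof.
rewrite /kdet; under [RHS]eq_bigr => f _ do rewrite mulr_sumr.
rewrite exchange_big; apply: eq_bigr => w _ /=.
under eq_bigr => j _ do rewrite !mxE.
rewrite bigA_distr_bigA scaler_sumr; apply: eq_bigr => f _ /=.
rewrite -scalerAr -big_split /=; congr (_ *: _).
by apply: eq_bigr => j _; rewrite mxE mulrC.
Qed.

Lemma wrdet_scale_rows (k n : nat) (s : 'I_(k * n) -> A)
    (M : 'M[A]_(k * n, n)) :
  wrdet (\matrix_(i, j) (s i * M i j)) = (\prod_i s i) * wrdet M.
Proof.
rewrite /wrdet /kdet mulr_sumr; apply: eq_bigr => w _ /=.
rewrite -scalerAr [\prod_i s i](reindex_inj (@perm_inj _ w)) -big_split /=.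
by congr (_ *: _); apply: eq_bigr => j _; rewrite !mxE.
Qed.

(** By the pigeonhole principle two indices of [S] get the same color, and
    erasing entries then keeps their columns equal. *)
Lemma kdet_eq_columns (k N : nat) (B : 'M[A]_N) (S : {set 'I_N}) :
  (0 < k)%N -> (k < #|S|)%N ->
  {in S &, forall j1 j2 i, B i j1 = B i j2} -> kdet k B = 0.
Proof.
move=> hk ltkS eqB; rewrite kdet_sum_det // big1 ?scaler0 // => c _.
have /dinjectivePn[i iS [j /andP[nij jS] cij]] : ~~ dinjectiveb c S.
  apply: contraL ltkS => /dinjectiveP inj; rewrite -leqNgt -(card_in_imset inj).
  by rewrite -[leqRHS](card_ord k) max_card.
rewrite -det_tr; apply: (determinant_alternate (i1 := j) (i2 := i)) => // l.
by rewrite !mxE cij (eqB j i).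
Qed.

Lemma card_repcol_fiber (k n : nat) (b : 'I_n) : (0 < k)%N ->
  (#|[set j : 'I_(k * n) | Ordinal (repcol_subproof j) == b]| <= k)%N.
Proof.
move=> hk; pose r (j : 'I_(k * n)) := Ordinal (ltn_pmod j hk).
rewrite -[leqRHS](card_ord k) -(card_in_imset (f := r)) ?max_card //.
move=> i j; rewrite !inE -!val_eqE /= => /eqP qi /eqP qj [rij].
by apply: val_inj; rewrite /= (divn_eq i k) (divn_eq j k) qi qj rij.
Qed.

(** The triangular case of the rule [wrdet (M *m Q) = \det Q ^+ k * wrdet M].
    In the expansion over column selections [f], either [f] repeats a column too
    often, or it equals [col], or it picks an entry of [T] on the zero side of
    the diagonal. *)
Lemma wrdet_mulmx_triangular (k n : nat) (M : 'M[A]_(k * n, n)) (T : 'M[A]_n) :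
  (0 < k)%N -> is_trig_mx T || is_trig_mx T^T ->
  wrdet (M *m T) = (\prod_c T c c) ^+ k * wrdet M.
Proof.
move=> hk trigT; pose col j := Ordinal (@repcol_subproof k n j).
have fib_col b : (#|[set j | col j == b]| <= k)%N by exact: card_repcol_fiber.
have cardI : #|'I_(k * n)| = (k * n)%N by rewrite card_ord.
rewrite /wrdet [LHS](kdet_expand_columns k col) (bigD1 (finfun col)) //=.
rewrite [X in _ + X]big1 ?addr0 => [|f neq_f].
  congr (_ * _); last first.
    by congr (kdet _ _); apply/matrixP=> i j; rewrite !mxE ffunE.
  rewrite (partition_big col xpredT) //= -prodrXl; apply: eq_bigr => c _.
  rewrite (eq_bigr (fun=> T c c)) => [|j /eqP jc]; last by rewrite ffunE jc.
  rewrite prodr_const; congr (_ ^+ _).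
  by rewrite -[RHS](balanced_fiber cardI fib_col c) cardsE.
have [/forallP fib_f|/forallPn[b]] :=
    boolP [forall b, (#|[set j | f j == b]| <= k)%N]; last first.
  rewrite -ltnNge => big_fib; rewrite (kdet_eq_columns hk big_fib) ?mulr0 //.
  by move=> j1 j2; rewrite !inE => /eqP e1 /eqP e2 i; rewrite !mxE e1 e2.
have vanish j : T (f j) (col j) = 0 ->
    (\prod_j T (f j) (col j)) * kdet k (\matrix_(i, j) M i (f j)) = 0.
  by move=> T0; rewrite (bigD1 j) //= T0 !mul0r.
case/orP: trigT => /is_trig_mxP trigT.
  have [/forallP le|/forallPn[j]] := boolP [forall j, (col j <= f j)%N].
    case/eqP: neq_f; apply/ffunP=> j; rewrite ffunE.
    by rewrite -(balanced_le_eq cardI fib_col fib_f le).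
  by rewrite -ltnNge => lt; apply: (vanish j); exact: trigT.
have [/forallP le|/forallPn[j]] := boolP [forall j, (f j <= col j)%N].
  case/eqP: neq_f; apply/ffunP=> j; rewrite ffunE.
  by rewrite -(balanced_le_eq cardI fib_f fib_col le).
by rewrite -ltnNge => lt; apply: (vanish j); have := trigT _ _ lt; rewrite mxE.
Qed.

End KDet.

(** * From the Cauchy matrix to the Vandermonde matrix *)

(** Telescoping: replace the factors [a l] by [a l - t] one at a time, from the
    left; the step at position [b] changes the product by [t] times the
    [b]-th summand.  For [t] equal to one of the [a l], the second product on
    the left vanishes. *)
Lemma prod_sub_prod_shift (A : comPzRingType) (t : A) (n : nat)
    (a : 'I_n -> A) :
  \prod_l a l - \prod_l (a l - t) =
  t * \sum_(b < n) (\prod_(l < n | (l < b)%N) (a l - t))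
                  * \prod_(l < n | (b < l)%N) a l.
Proof.
elim: n a => [|n IH] a; first by rewrite !big_ord0 mulr0 subrr.
rewrite !big_ord_recl /=.
have E0 : (\prod_(l < n.+1 | (l < 0)%N) (a l - t))
    * (\prod_(l < n.+1 | (0 < l)%N) a l) = \prod_(l < n) a (lift ord0 l).
  by rewrite big_pred0 // mul1r big_mkcond big_ord_recl /= mul1r.
have ES (b : 'I_n) : (\prod_(l < n.+1 | (l < lift ord0 b)%N) (a l - t))
    * (\prod_(l < n.+1 | (lift ord0 b < l)%N) a l)
  = (a ord0 - t) * ((\prod_(l < n | (l < b)%N) (a (lift ord0 l) - t))
    * \prod_(l < n | (b < l)%N) a (lift ord0 l)).
  rewrite [X in X * _ = _]big_mkcond [X in _ * X = _]big_mkcond /=.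
  by rewrite !big_ord_recl /= mul1r -!big_mkcond -mulrA.
rewrite E0 (eq_bigr _ (fun b _ => ES b)) -mulr_sumr [RHS]mulrDr mulrCA -IH.
by rewrite mulrBr addrA -mulrDl [t + _]addrCA subrr addr0.
Qed.

(** Column [b] consists of the values at the [x i] of a monic polynomial of
    degree [n - b.+1]; its coefficients form column [b] of [T]. *)
Lemma shifted_prods_vandermx (A : comNzRingType) (n k : nat)
    (x : 'I_(k * n) -> A) (y : 'I_n -> A) :
  exists2 T : 'M[A]_n, is_trig_mx T && [forall c, T c c == 1] &
    \matrix_(i, b) \prod_(l < n | (b < l)%N) (x i + y l) = vandermx x *m T.
Proof.
pose G (b : 'I_n) : {poly A} := \prod_(l < n | (b < l)%N) ('X - (- y l)%:P).
have sG b : size (G b) = (n - b)%N.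
  have card_gt : #|[pred l : 'I_n | (b < l)%N]| = (n - b.+1)%N.
    by rewrite -sum1_card -[RHS]muln1 -sum_nat_const_nat big_geq_mkord.
  rewrite /G -big_filter size_prod_XsubC size_filter -sum1_count.
  by rewrite sum1_card card_gt subnSK.
exists (\matrix_(m, b) (G b)`_(n - m.+1)).
  apply/andP; split.
    apply/is_trig_mxP => m b mb; rewrite mxE nth_default // sG.
    by rewrite leq_sub2l.
  apply/forallP=> c; rewrite mxE; have /monicP <- : G c \is monic.
    exact: monic_prod_XsubC.
  by rewrite lead_coefE sG subnS.
apply/matrixP=> i b; rewrite !mxE.
have -> : \prod_(l < n | (b < l)%N) (x i + y l) = (G b).[x i].
  rewrite horner_prod; apply: eq_bigr => l _.
  by rewrite hornerXsubC opprK.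
rewrite (@horner_coef_wide _ n) ?sG ?leq_subr // (reindex_inj rev_ord_inj) /=.
by apply: eq_bigr => m _; rewrite !mxE mulrC.
Qed.

Theorem proposition6p1 (R : realType) (A : comUnitAlgType R[i]) (n k : nat)
    (hk : (0 < k)%N)
    (x : 'I_(k * n) -> A) (y : 'I_n -> A)
    (hxy : forall (i : 'I_(k * n)) (j : 'I_n), x i + y j \is a GRing.unit) :
  wrdet (cauchymx x y) =
    vdprod y ^+ k / (\prod_(i < k * n) \prod_(j < n) (x i + y j))
      * wrdet (vandermx x).
Proof.
have [T /andP[trigT /forallP T1] eqT] := shifted_prods_vandermx x y.
pose N : 'M[A]_n := \matrix_(b, j) \prod_(l < n | (l < b)%N) (y l - y j).
pose s i := (\prod_(l < n) (x i + y l))^-1.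
have -> : cauchymx x y = \matrix_(i, j) (s i * (vandermx x *m T *m N) i j).
  apply/matrixP=> i j; rewrite -eqT !mxE /s.
  (* With [t = x i + y j] the shifted factors are the [y l - y j], and the one
     for [l = j] is zero. *)
  have := prod_sub_prod_shift (x i + y j) (fun l => x i + y l).
  rewrite [X in _ - X](bigD1 j) //= subrr mul0r subr0 => E.
  apply: (mulrI (hxy i j)); rewrite divrr // mulrCA.
  have U : \prod_(l < n) (x i + y l) \is a GRing.unit.
    by rewrite unitr_prod.
  apply: (mulrI U); rewrite mulr1 mulVKr // {1}E; congr (_ * _).
  apply: eq_bigr => b _; rewrite !mxE mulrC; congr (_ * _).
  by apply: eq_bigr => l _; rewrite opprD addrACA subrr add0r.
rewrite wrdet_scale_rows wrdet_mulmx_triangular //; last first.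
  apply/orP; right; apply/is_trig_mxP=> j b jb; rewrite !mxE.
  by rewrite (bigD1 j) //= subrr mul0r.
rewrite wrdet_mulmx_triangular ?trigT //.
rewrite [\prod_c T c c]big1 => [|c _]; last exact/eqP.
rewrite expr1n mul1r mulrA [_ / _]mulrC; congr (_ * _ ^+ k * _).
  apply: prodrV => i _; exact: unitr_prod.
rewrite /vdprod (exchange_big_dep xpredT) //=; apply: eq_bigr => c _.
by rewrite mxE.
Qed.
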